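(* Let $d\in\mathbb N$, let $G_0\in\mathbb R^{d\times d}$ be a symmetric positive definite matrix, and let $\lambda>0$ be an eigenvalue of even multiplicity $m>2$ of the Laplacian on the flat torus with Gram matrix $G_0$, with corresponding lattice vectors $\pm v_j\in\mathbb Z^d$, $j=1,\ldots,\frac m2$; i.e. $\{w\in\mathbb Z^d: 4\pi^2 w^tG_0w=\lambda\}=\{\pm v_1,\ldots,\pm v_{m/2}\}$ has exactly $m$ elements. Let $\Lambda=(\det G_0)^{-1/d}\lambda$ and $$M_j=-\frac{\Lambda}{d}G_0^{-1}+4\pi^2(\det G_0)^{-1/d}\,v_jv_j^t,\qquad j=1,\ldots,\tfrac m2 .$$ Then $G_0$ is a stationary point for $\Lambda$ if and only if there are non-negative coefficients $c_j\ge 0$, $j=1,\ldots,\frac m2$, not all zero, such that $\sum_{j=1}^{m/2}c_jM_j=0$.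
   Context: For $B\in GL(d,\mathbb R)$, the flat torus $T_B=\mathbb R^d/B\mathbb Z^d$ has Gram matrix $G=B^{-1}B^{-t}$ (symmetric positive definite). The eigenvalues of $-\Delta$ on $T_B$, counted with multiplicity, are the numbers $4\pi^2 w^tGw$, $w\in\mathbb Z^d$. For a symmetric perturbation $\delta G\in\mathbb R^{d\times d}$, set $\mu_j=\mu_j(\delta G)=\langle M_j,\delta G\rangle_F$, where $\langle X,Y\rangle_F=\operatorname{tr}(X^tY)$ is the Frobenius inner product. Definition: $G_0$ is a stationary point for $\Lambda$ if for every symmetric $\delta G$ there exists at least one $j\in\{1,\ldots,\frac m2\}$ such that $\mu_j(\delta G)\le 0$. *)

(* Defs.v *)
From HB Require Import structures.
From mathcomp Require Import all_boot all_order all_algebra.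
From mathcomp Require Import all_classical all_reals all_analysis.

Set Implicit Arguments.
Unset Strict Implicit.
Unset Printing Implicit Defensive.

Import Order.TTheory GRing.Theory Num.Theory.

Local Open Scope classical_set_scope.
Local Open Scope ring_scope.

Definition symmetric_mx (R : realType) (d : nat) (A : 'M[R]_d) : Prop :=
  A^T = A.

Definition posdef_mx (R : realType) (d : nat) (A : 'M[R]_d) : Prop :=
  forall x : 'cV[R]_d, x != 0 -> 0 < (x^T *m A *m x) 0 0.

Definition frobenius (R : realType) (d : nat) (X Y : 'M[R]_d) : R :=
  \tr (X^T *m Y).

Definition lattice_vec (R : realType) (d : nat) (w : 'cV[int]_d) : 'cV[R]_d :=
  map_mx intr w.

(* The torus R^d / B Z^d with Gram matrix G = B^-1 B^-T has the Laplace
   eigenfunctions x |-> exp (2 pi i (B^-T w) . x), w in Z^d, and the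
   eigenvalue belonging to w is 4 pi^2 |B^-T w|^2 = 4 pi^2 w^T G w. *)
Definition torus_eig (R : realType) (d : nat) (G : 'M[R]_d)
    (w : 'cV[int]_d) : R :=
  4 * pi ^+ 2 * ((lattice_vec R w)^T *m G *m lattice_vec R w) 0 0.

Definition eig_lattice (R : realType) (d : nat) (G : 'M[R]_d) (lambda : R) :
    set 'cV[int]_d :=
  [set w | torus_eig G w = lambda].

(* Each lattice vector contributes one eigenfunction, so the multiplicity of
   lambda is the number of w with torus_eig G w = lambda; it is an eigenvalue
   when this number is positive. *)
Definition eigenvalue_mult (R : realType) (d : nat) (G : 'M[R]_d) (lambda : R)
    (m : nat) : Prop :=
  (0 < m)%N /\ (eig_lattice G lambda #= `I_m)%card.

Definition Lambda (R : realType) (d : nat) (G : 'M[R]_d) (lambda : R) : R :=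
  (\det G) `^ (- (d%:R)^-1) * lambda.

Definition Mmx (R : realType) (d : nat) (G : 'M[R]_d) (lambda : R)
    (w : 'cV[int]_d) : 'M[R]_d :=
  - (Lambda G lambda / d%:R) *: invmx G
  + (4 * pi ^+ 2 * (\det G) `^ (- (d%:R)^-1))
      *: (lattice_vec R w *m (lattice_vec R w)^T).

Definition mu (R : realType) (d : nat) (G : 'M[R]_d) (lambda : R)
    (w : 'cV[int]_d) (dG : 'M[R]_d) : R :=
  frobenius (Mmx G lambda w) dG.

(* The family v lists one vector out of each pair +-v_j of the eigenvalue
   lambda; mu takes the same value at v_j and - v_j. *)
Definition stationary_point (R : realType) (d k : nat) (G : 'M[R]_d)
    (lambda : R) (v : 'I_k -> 'cV[int]_d) : Prop :=
  forall dG : 'M[R]_d, symmetric_mx dG ->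
    exists j : 'I_k, mu G lambda (v j) dG <= 0.

(* Main.v *)
(** This is Gordan's alternative for the vectors [M_j] in the Euclidean
    space of matrices: either some [Y] has [<M_j, Y> > 0] for all [j], or some
    nontrivial non-negative combination of the [M_j] vanishes.  The [M_j] are
    symmetric, so a strictly positive [Y] may be replaced by [Y + Y^T].
    Gordan's alternative is proved by induction on the number of vectors: given
    [y] positive on [a_1, .., a_k] but not on [a_0], apply the induction
    hypothesis to [b_j = <a_j, y> a_0 - <a_0, y> a_j], which are non-negative
    combinations of [a_0] and [a_j] orthogonal to [y]. *)
Require Import Defs.
From HB Require Import structures.
From mathcomp Require Import all_boot all_order all_algebra.
From mathcomp Require Import all_classical all_reals all_analysis.
From mathcomp Require Import ring lra.

Import Order.TTheory GRing.Theory Num.Theory.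

Local Open Scope classical_set_scope.
Local Open Scope ring_scope.

(** With [M] equal to 1 plus the sum of all [|q i| / p i], already
    [M * p j >= p j + |q j| > - q j]. *)
Lemma exists_dominating_scale {R : realFieldType} {k : nat}
    {p : 'I_k -> R} (q : 'I_k -> R) :
  (forall j, 0 < p j) -> exists M : R, forall j, 0 < M * p j + q j.
Proof.
move=> p_gt0; exists (1 + \sum_j `|q j| / p j) => j.
have rest_ge0 : 0 <= \sum_(i | i != j) `|q i| / p i.
  by apply: sumr_ge0 => i _; rewrite divr_ge0 // ltW.
rewrite (bigD1 j) //= addrCA mulrDl divfK ?gt_eqF //.
have := mulr_gt0 (ltr_pwDl ltr01 rest_ge0) (p_gt0 j).
have := ler_norm (- q j); rewrite normrN; lra.
Qed.

Theorem gordan {R : realFieldType} {V : lmodType R} {dot : V -> V -> R}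
    (dot_linearl : forall y, scalar (dot^~ y))
    (dot_linearr : forall x, scalar (dot x))
    (dot_gt0 : forall x, x != 0 -> 0 < dot x x)
    {k : nat} (a : 'I_k -> V) :
  (exists y, forall j, 0 < dot (a j) y) \/
  exists c : 'I_k -> R,
    [/\ forall j, 0 <= c j, exists j, c j != 0 & \sum_j c j *: a j = 0].
Proof.
elim: k a => [|k IHk] a; first by left; exists 0; case.
pose a0 := a ord0; pose a' j := a (lift ord0 j).
have [[y y_gt0]|[c [c_ge0 [j cj_neq0] sum0]]] := IHk a'; last first.
  right; exists (fun i => oapp c 0 (unlift ord0 i)); split.
  - by move=> i; case: unliftP => [i' _|_] /=.
  - by exists (lift ord0 j); rewrite liftK.
  - rewrite big_ord_recl unlift_none /= scale0r add0r -[RHS]sum0.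
    by apply: eq_bigr => i _; rewrite liftK.
have [a0y_gt0|a0y_le0] := ltP 0 (dot a0 y).
  by left; exists y => i; case: (unliftP ord0 i) => [i' ->|->]; [exact: y_gt0|].
(* A zero [a0] is by itself a vanishing combination; otherwise [dot a0 a0 > 0]. *)
have [a0_eq0|a0_neq0] := eqVneq a0 0.
  right; exists (fun i => (i == ord0)%:R); split.
  - by move=> i; rewrite ler0n.
  - by exists ord0; rewrite eqxx oner_eq0.
  - rewrite big_ord_recl eqxx scale1r -/a0 a0_eq0 add0r.
    by apply: big1 => i _; rewrite scale0r.
pose b j := dot (a' j) y *: a0 + - dot a0 y *: a' j.
have dotr x s u w : dot x (s *: u + w) = s * dot x u + dot x w.
  exact: dot_linearr.
have dot0l x : dot 0 x = 0.
  have := dot_linearl x 1 0 0; rewrite scaler0 addr0 /= mul1r; lra.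
have dotl s u t w x : dot (s *: u + t *: w) x = s * dot u x + t * dot w x.
  rewrite dot_linearl /=; congr (_ + _).
  by rewrite -[t *: w]addr0 dot_linearl /= dot0l addr0.
have [[z z_gt0]|[c [c_ge0 [j cj_neq0] sum0]]] := IHk b.
- (* [w] is orthogonal to [a0] and positive on every [a' j]; a small multiple
     of [a0] added to [w] makes [a0] positive as well. *)
  pose w := - dot a0 y *: z + (dot a0 z *: y + 0).
  have dot_x0 x : dot x 0 = 0.
    have := dot_linearr x 1 0 0; rewrite scaler0 addr0 /= mul1r; lra.
  (* By bilinearity [dot (a' j) w = dot (b j) z]. The final [+ 0] in [w] gives it the shape that
     [dotr] rewrites. *)
  have w_gt0 j : 0 < dot (a' j) w.
    by have := z_gt0 j; rewrite /b /w dotl !dotr dot_x0; lra.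
  have [M M_gt0] := exists_dominating_scale (fun j => dot (a' j) a0) w_gt0.
  left; exists (M *: w + a0) => i; rewrite dotr.
  case: (unliftP ord0 i) => [i' ->|->]; first exact: M_gt0.
  have -> : dot (a ord0) w = 0 by rewrite -/a0 /w !dotr dot_x0; ring.
  by rewrite mulr0 add0r dot_gt0.
(* Expanding the vanishing sum of the [c j *: b j] leaves [c0] on [a0] and [- dot a0 y * c j] on
   [a' j]. *)
right; pose c0 := \sum_j c j * dot (a' j) y.
exists (fun i => oapp (fun j => - dot a0 y * c j) c0 (unlift ord0 i)); split.
- move=> i; case: unliftP => [i' _|_] /=; first by rewrite mulr_ge0 ?oppr_ge0.
  by apply: sumr_ge0 => i' _; rewrite mulr_ge0 // ltW.
(* Index 0 is the safe witness: [dot a0 y] may be 0, which kills all other coefficients, while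
   [c0 > 0]. *)
- exists ord0; rewrite unlift_none /= gt_eqF // /c0 (bigD1 j) //=.
  apply: ltr_pwDl; first by rewrite mulr_gt0 // lt_def cj_neq0 c_ge0.
  by apply: sumr_ge0 => i' _; rewrite mulr_ge0 // ltW.
- rewrite big_ord_recl unlift_none /= -[RHS]sum0 scaler_suml -big_split /=.
  apply: eq_bigr => i _; rewrite liftK /= /b scalerDr !scalerA.
  by rewrite [- _ * _]mulrC.
Qed.

Lemma frobenius_linearl {R : realType} {d : nat} (Y : 'M[R]_d) :
  scalar ((@frobenius R d)^~ Y).
Proof.
by move=> s A B; rewrite /frobenius linearP mulmxDl -scalemxAl linearP.
Qed.

Lemma frobenius_linearr {R : realType} {d : nat} (X : 'M[R]_d) :
  scalar (frobenius X).
Proof. by move=> s A B; rewrite /frobenius mulmxDr -scalemxAr linearP. Qed.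

Lemma frobenius_gt0 {R : realType} {d : nat} (X : 'M[R]_d) :
  X != 0 -> 0 < frobenius X X.
Proof.
have sq_ge0 i : 0 <= \sum_j X j i ^+ 2 by apply: sumr_ge0 => j _; exact: sqr_ge0.
have frobE : frobenius X X = \sum_i \sum_j X j i ^+ 2.
  apply: eq_bigr => i _; rewrite !mxE.
  by apply: eq_bigr => j _; rewrite !mxE expr2.
move=> X_neq0; rewrite lt_def frobE sumr_ge0 // andbT.
apply: contra X_neq0; rewrite psumr_eq0 // => /allP X0.
apply/eqP/matrixP => j i; rewrite mxE.
have := X0 i (mem_index_enum i); rewrite psumr_eq0 => [/allP/(_ j)|j' _].
  by move=> /(_ (mem_index_enum j)); rewrite sqrf_eq0 => /eqP.
exact: sqr_ge0.
Qed.

(** The trace is invariant under transposition and cyclic permutation. *)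
Lemma frobenius_trmx {R : realType} {d : nat} (X Y : 'M[R]_d) :
  symmetric_mx X -> frobenius X Y^T = frobenius X Y.
Proof.
by move=> symX; rewrite /frobenius -mxtrace_tr trmx_mul !trmxK mxtrace_mulC symX.
Qed.

Lemma Mmx_sym {R : realType} {d : nat} (G : 'M[R]_d) (lambda : R)
    (w : 'cV[int]_d) : symmetric_mx G -> symmetric_mx (Mmx G lambda w).
Proof.
move=> symG.
by rewrite /symmetric_mx /Mmx linearD !linearZ /= trmx_inv symG trmx_mul trmxK.
Qed.

Theorem theorem3p4 (R : realType) (d : nat) (hd : (0 < d)%N)
    (G0 : 'M[R]_d) (hsym : symmetric_mx G0) (hpos : posdef_mx G0)
    (lambda : R) (hlambda : 0 < lambda)
    (m : nat) (hm_even : ~~ odd m) (hm : (2 < m)%N)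
    (hmult : eigenvalue_mult G0 lambda m)
    (v : 'I_m./2 -> 'cV[int]_d)
    (hv : eig_lattice G0 lambda = [set w | exists j, w = v j \/ w = - v j]) :
  stationary_point G0 lambda v <->
  exists c : 'I_m./2 -> R,
    [/\ forall j, 0 <= c j,
        exists j, c j != 0
      & \sum_(j < m./2) c j *: Mmx G0 lambda (v j) = 0].
Proof.
split=> [stat|[c [c_ge0 [j cj_neq0] sum0]] dG _].
  have [[Y Y_gt0]|//] := gordan frobenius_linearl frobenius_linearr
    frobenius_gt0 (fun j => Mmx G0 lambda (v j)).
  (* Symmetrizing doubles each pairing with [Mmx]; the factor [1 *:] fits [frobenius_linearr]. *)
  have symY : symmetric_mx (1 *: Y + Y^T).
    by rewrite /symmetric_mx scale1r linearD /= trmxK addrC.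
  have [j] := stat _ symY; rewrite /mu frobenius_linearr /= mul1r.
  by rewrite frobenius_trmx ?leNgt ?addr_gt0 //; exact: Mmx_sym.
have [//|noneg] := pselect (exists j, mu G0 lambda (v j) dG <= 0).
have mu_gt0 i : 0 < mu G0 lambda (v i) dG.
  by rewrite ltNge; apply/negP => le0; apply: noneg; exists i.
(* This sum is also the pairing of the zero combination with [dG], hence a contradiction. *)
have : 0 < \sum_i c i * mu G0 lambda (v i) dG.
  rewrite (bigD1 j) //=; apply: ltr_pwDl.
    by rewrite mulr_gt0 // lt_def cj_neq0 c_ge0.
  by apply: sumr_ge0 => i _; rewrite mulr_ge0 // ltW.
suff -> : \sum_i c i * mu G0 lambda (v i) dG = 0 by rewrite ltxx.
rewrite -[RHS](_ : frobenius 0 dG = 0); last first.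
  by rewrite /frobenius trmx0 mul0mx mxtrace0.
rewrite -sum0 /frobenius linear_sum mulmx_suml linear_sum /=.
by apply: eq_bigr => i _; rewrite linearZ -scalemxAl mxtraceZ.
Qed.
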